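(* Let $v=(x,y,z)^T\in\mathbb{O}^3$ with $\operatorname{Re}(x)=\operatorname{Re}(y)=\operatorname{Re}(z)=0$ and associator $[v]:=[x,y,z]\neq0$. Then the set of $3\times3$ Hermitian octonionic matrices $A$ satisfying $Av=v[v]$ is nonempty and forms a 6-parameter family: identifying such $A$ with $(p,m,n,a,b,c)\in\mathbb{R}^3\times\mathbb{O}^3\cong\mathbb{R}^{27}$, the solution set is a real affine subspace of dimension $6$. Specifically, in a basis where $x=x_2 i$, $y=y_2 i+y_3 j$, $z=z_2 i+z_3 j+z_4 k+z_8\ell$, the diagonal entries $p,m,n$ and the components $b_1,b_4,b_7$ of $b$ (coefficients of $1,k,i\ell$) may be chosen freely, and the remaining entries of $A$ are then uniquely determined.
   Context: $\mathbb{O}$ denotes the real octonions, constructed by Cayley–Dickson as $\mathbb{H}\oplus\mathbb{H}\ell$ with basis $1,i,j,k,k\ell,j\ell,i\ell,\ell$; octonions are written $w=w_1+w_2 i+w_3 j+w_4 k+w_5 k\ell+w_6 j\ell+w_7 i\ell+w_8\ell$, and $\operatorname{Re}(w)=w_1$. The associator is $[x,y,z]=(xy)z-x(yz)$. Any triple of octonions can be put in the ''generic'' form $x=x_1+x_2 i$, $y=y_1+y_2 i+y_3 j$, $z=z_1+z_2 i+z_3 j+z_4 k+z_8\ell$ by a suitable choice of basis; then $[x,y,z]=2x_2y_3z_8\,k\ell$. A $3\times3$ Hermitian octonionic matrix has the form $A=\begin{pmatrix} p & a & \bar c\\ \bar a & m & b\\ c & \bar b & n\end{pmatrix}$ with $p,m,n\in\mathbb{R}$,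 $a,b,c\in\mathbb{O}$. $Av=v[v]$ means $px+ay+\bar c z = x[v]$, $\bar a x+my+bz=y[v]$, $cx+\bar b y+nz=z[v]$ (octonionic products). *)

(* Defs.v *)
From HB Require Import structures.
From mathcomp Require Import all_boot all_order all_algebra.
Set Implicit Arguments. Unset Strict Implicit. Unset Printing Implicit Defensive.
Import Order.TTheory GRing.Theory Num.Theory.
Local Open Scope ring_scope.

Section Octonions.
Variable R : comRingType.

(* Octonion w = w1 + w2 i + w3 j + w4 k + w5 kl + w6 jl + w7 il + w8 l
   is stored as the row vector with entry (0, inord (r-1)) = w_r. *)
Definition oct := 'rV[R]_8.

Definition ocomp (w : oct) (r : nat) : R := w 0 (inord r).

Definition mkoct (s : seq R) : oct := \row_(k < 8) nth 0 s k.

Definition quat := (R * R * R * R)%type.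

Definition qmul (p q : quat) : quat :=
  let '(a1, a2, a3, a4) := p in
  let '(b1, b2, b3, b4) := q in
  (a1*b1 - a2*b2 - a3*b3 - a4*b4,
   a1*b2 + a2*b1 + a3*b4 - a4*b3,
   a1*b3 - a2*b4 + a3*b1 + a4*b2,
   a1*b4 + a2*b3 - a3*b2 + a4*b1).

Definition qconj (p : quat) : quat :=
  let '(a1, a2, a3, a4) := p in (a1, - a2, - a3, - a4).

Definition qsub (p q : quat) : quat :=
  let '(a1, a2, a3, a4) := p in
  let '(b1, b2, b3, b4) := q in (a1 - b1, a2 - b2, a3 - b3, a4 - b4).

Definition qadd (p q : quat) : quat :=
  let '(a1, a2, a3, a4) := p in
  let '(b1, b2, b3, b4) := q in (a1 + b1, a2 + b2, a3 + b3, a4 + b4).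

(* Cayley-Dickson split w = a + d l with a, d quaternions:
   a = w1 + w2 i + w3 j + w4 k,  d = w8 + w7 i + w6 j + w5 k
   (since (d2 i) l = d2 il, (d3 j) l = d3 jl, (d4 k) l = d4 kl). *)
Definition ofst (w : oct) : quat :=
  (ocomp w 0, ocomp w 1, ocomp w 2, ocomp w 3).
Definition osnd (w : oct) : quat :=
  (ocomp w 7, ocomp w 6, ocomp w 5, ocomp w 4).

Definition ofpair (a d : quat) : oct :=
  let '(a1, a2, a3, a4) := a in
  let '(d1, d2, d3, d4) := d in
  mkoct [:: a1; a2; a3; a4; d4; d3; d2; d1].

(* Cayley-Dickson product: (a + b l)(c + d l) = (a c - conj(d) b) + (d a + b conj(c)) l *)
Definition omul (w u : oct) : oct :=
  let a := ofst w in let b := osnd w in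
  let c := ofst u in let d := osnd u in
  ofpair (qsub (qmul a c) (qmul (qconj d) b)) (qadd (qmul d a) (qmul b (qconj c))).

Definition oconj (w : oct) : oct :=
  \row_(k < 8) (if k == ord0 then w 0 k else - w 0 k).

Definition ore (w : oct) : R := ocomp w 0.

Definition oassoc (x y z : oct) : oct := omul (omul x y) z - omul x (omul y z).

(* A 3x3 Hermitian octonionic matrix
     ( p     a     conj c )
     ( conj a  m     b    )
     ( c     conj b  n    )
   is identified with h = (p, m, n, a, b, c) in R^3 x O^3 = R^27,
   with coordinates ordered p, m, n, a1..a8, b1..b8, c1..c8. *)
Definition hp (h : 'rV[R]_27) : R := h 0 (inord 0).
Definition hm (h : 'rV[R]_27) : R := h 0 (inord 1).
Definition hn (h : 'rV[R]_27) : R := h 0 (inord 2).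
Definition ha (h : 'rV[R]_27) : oct := \row_(k < 8) h 0 (inord (3 + k)).
Definition hb (h : 'rV[R]_27) : oct := \row_(k < 8) h 0 (inord (11 + k)).
Definition hc (h : 'rV[R]_27) : oct := \row_(k < 8) h 0 (inord (19 + k)).

Definition eigen_eq (h : 'rV[R]_27) (x y z : oct) : Prop :=
  let t := oassoc x y z in
  [/\ hp h *: x + omul (ha h) y + omul (oconj (hc h)) z = omul x t,
      omul (oconj (ha h)) x + hm h *: y + omul (hb h) z = omul y t &
      omul (hc h) x + omul (oconj (hb h)) y + hn h *: z = omul z t].

Definition generic_form (x y z : oct) : Prop :=
  (forall r, r != 1%N -> ocomp x r = 0) /\
  (forall r, r \notin [:: 1; 2]%N -> ocomp y r = 0) /\
  (forall r, r \notin [:: 1; 2; 3; 7]%N -> ocomp z r = 0).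

End Octonions.

(* Main.v *)
Require Import Defs.
From HB Require Import structures.
From mathcomp Require Import all_boot all_order all_algebra.
From mathcomp Require Import ring zify.
Import Order.TTheory GRing.Theory Num.Theory.
Local Open Scope ring_scope.
Set Implicit Arguments. Unset Strict Implicit. Unset Printing Implicit Defensive.

(* Gram-Schmidt without normalisation (no square roots are available in [R])
   writes [y = y2 x + e2] and [z = z2 x + z3 e2 + z4 (x e2) + e4], with [x], [e2],
   [e4] imaginary, mutually orthogonal and [e4] orthogonal to [x e2]. Three
   Cayley-Dickson doublings show that the products of [x], [e2], [e4] form a basis
   of the octonions whose multiplication table depends only on
   [al = |x|^2, be = |e2|^2, ga = |e4|^2]; the generic form is the case where this
   basis is a rescaling of the standard one. Since [[x,y,z] = 2 (x e2) e4], the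
   three norms are nonzero.

   In these coordinates the second and third rows of [A v = v [v]] determine [a]
   and [c] from [b], because right multiplication by [x] squares to [- al]. After
   this substitution the first row fixes [b1, b2, b4, b5, b7] in terms of the free
   [p, m, n, b0, b3, b6] (coordinates numbered from 0); the decisive coefficient
   [2 be (ga + al be z4^2)] is positive. Six linear functionals that parametrise an affine set bijectively
   give its dimension. *)

(** * Coordinates and identities of the octonions *)

Section OctonionIdentities.
Variable R : comNzRingType.
Implicit Types (u v w : oct R) (s : seq R).

Lemma ocomp_mkoct s r : (r < 8)%N -> ocomp (mkoct s) r = nth 0 s r.
Proof. by move=> r8; rewrite /ocomp mxE inordK. Qed.

Lemma oct_eta u : u = mkoct [seq ocomp u r | r <- iota 0 8].
Proof.
apply/rowP => k; rewrite mxE (nth_map 0%N) ?size_iota ?ltn_ord//.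
by rewrite nth_iota ?ltn_ord// /ocomp inord_val.
Qed.

Lemma octP u :
  exists u0 u1 u2 u3 u4 u5 u6 u7 : R, u = mkoct [:: u0; u1; u2; u3; u4; u5; u6; u7].
Proof. by rewrite (oct_eta u); do 8 eexists. Qed.

Lemma mkoctD (a0 a1 a2 a3 a4 a5 a6 a7 b0 b1 b2 b3 b4 b5 b6 b7 : R) :
  mkoct [:: a0; a1; a2; a3; a4; a5; a6; a7]
  + mkoct [:: b0; b1; b2; b3; b4; b5; b6; b7] =
  mkoct [:: a0 + b0; a1 + b1; a2 + b2; a3 + b3; a4 + b4; a5 + b5; a6 + b6; a7 + b7].
Proof. by apply/rowP => -[[|[|[|[|[|[|[|[|//]]]]]]]] k8]; rewrite !mxE. Qed.

Lemma mkoctZ a s : a *: mkoct s = mkoct [seq a * c | c <- s].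
Proof.
apply/rowP => k; rewrite !mxE.
have [ks|ks] := ltnP k (size s); first by rewrite (nth_map 0).
by rewrite !nth_default ?mulr0 ?size_map.
Qed.

Lemma mkoctN s : - mkoct s = mkoct [seq - c | c <- s].
Proof.
apply/rowP => k; rewrite !mxE.
have [ks|ks] := ltnP k (size s); first by rewrite (nth_map 0).
by rewrite !nth_default ?oppr0 ?size_map.
Qed.

Lemma mkoct_conj a s : oconj (mkoct (a :: s)) = mkoct (a :: [seq - c | c <- s]).
Proof.
apply/rowP => k; rewrite !mxE; case: k => [[|k] k8] //=.
have [ks|ks] := ltnP k (size s); first by rewrite (nth_map 0).
by rewrite !nth_default ?oppr0 ?size_map.
Qed.

Lemma mkoctM (a0 a1 a2 a3 a4 a5 a6 a7 b0 b1 b2 b3 b4 b5 b6 b7 : R) :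
  omul (mkoct [:: a0; a1; a2; a3; a4; a5; a6; a7])
       (mkoct [:: b0; b1; b2; b3; b4; b5; b6; b7]) =
  mkoct
   [:: a0 * b0 - a1 * b1 - a2 * b2 - a3 * b3 - a4 * b4 - a5 * b5 - a6 * b6 - a7 * b7;
       a0 * b1 + a1 * b0 + a2 * b3 - a3 * b2 + a4 * b5 - a5 * b4 - a6 * b7 + a7 * b6;
       a0 * b2 - a1 * b3 + a2 * b0 + a3 * b1 - a4 * b6 - a5 * b7 + a6 * b4 + a7 * b5;
       a0 * b3 + a1 * b2 - a2 * b1 + a3 * b0 - a4 * b7 + a5 * b6 - a6 * b5 + a7 * b4;
       a0 * b4 - a1 * b5 + a2 * b6 + a3 * b7 + a4 * b0 + a5 * b1 - a6 * b2 - a7 * b3;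
       a0 * b5 + a1 * b4 + a2 * b7 - a3 * b6 - a4 * b1 + a5 * b0 + a6 * b3 - a7 * b2;
       a0 * b6 + a1 * b7 - a2 * b4 + a3 * b5 + a4 * b2 - a5 * b3 + a6 * b0 - a7 * b1;
       a0 * b7 - a1 * b6 - a2 * b5 - a3 * b4 + a4 * b3 + a5 * b2 + a6 * b1 + a7 * b0].
Proof.
rewrite /omul /ofst /osnd !ocomp_mkoct //=.
by congr (mkoct [:: _; _; _; _; _; _; _; _]); ring.
Qed.

End OctonionIdentities.

Ltac oct_coords u :=
  let E := fresh in
  have [? [? [? [? [? [? [? [? E]]]]]]]] := octP u;
  move: E => ->.

(* Syntactic matching is needed here: [rewrite] would unify [mkoct _] with an
   unevaluated product by unfolding [omul]. *)
Ltac oct_simpl :=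
  repeat (match goal with
  | |- context [omul (mkoct ?s) (mkoct ?t)] =>
      rewrite [omul (mkoct s) (mkoct t)]mkoctM
  | |- context [oconj (mkoct ?s)] => rewrite [oconj (mkoct s)]mkoct_conj
  | |- context [?c *: ?x] =>
      match x with mkoct ?s => rewrite [c *: x]mkoctZ end
  | |- context [- ?x] => match x with mkoct ?s => rewrite [- x]mkoctN end
  | |- context [?x + ?y] =>
      match x with mkoct ?s =>
      match y with mkoct ?t => rewrite [x + y]mkoctD end end
  end; cbn [map]).

Ltac oct_ring := oct_simpl; congr (mkoct [:: _; _; _; _; _; _; _; _]); ring.

(** * Inner product, conjugation and the doubling identity *)

Section Orthogonality.
Variable R : comNzRingType.
Implicit Types (a b : R) (u v w p q r s : oct R).

Definition oone : oct R := mkoct [:: 1; 0; 0; 0; 0; 0; 0; 0].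

(** The Euclidean inner product, written through the product so that additivity and homogeneity are
    inherited from [omul]. *)
Definition odot u v := ore (omul u (oconj v)).

Lemma ore_mkoct a (t : seq R) : ore (mkoct (a :: t)) = a.
Proof. by rewrite /ore ocomp_mkoct. Qed.

Lemma odot_mkoct (a0 a1 a2 a3 a4 a5 a6 a7 b0 b1 b2 b3 b4 b5 b6 b7 : R) :
  odot (mkoct [:: a0; a1; a2; a3; a4; a5; a6; a7])
       (mkoct [:: b0; b1; b2; b3; b4; b5; b6; b7]) =
  a0 * b0 + a1 * b1 + a2 * b2 + a3 * b3 + a4 * b4 + a5 * b5 + a6 * b6 + a7 * b7.
Proof. by rewrite /odot; oct_simpl; rewrite ore_mkoct; ring. Qed.

Lemma omulDl u v w : omul (u + v) w = omul u w + omul v w.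
Proof. by oct_coords u; oct_coords v; oct_coords w; oct_ring. Qed.

Lemma omulDr u v w : omul u (v + w) = omul u v + omul u w.
Proof. by oct_coords u; oct_coords v; oct_coords w; oct_ring. Qed.

Lemma omulZl a u v : omul (a *: u) v = a *: omul u v.
Proof. by oct_coords u; oct_coords v; oct_ring. Qed.

Lemma omulZr a u v : omul u (a *: v) = a *: omul u v.
Proof. by oct_coords u; oct_coords v; oct_ring. Qed.

Lemma omulNl u v : omul (- u) v = - omul u v.
Proof. by rewrite -scaleN1r omulZl scaleN1r. Qed.

Lemma omulNr u v : omul u (- v) = - omul u v.
Proof. by rewrite -scaleN1r omulZr scaleN1r. Qed.

Lemma omul1l u : omul oone u = u.
Proof. by rewrite /oone; oct_coords u; oct_ring. Qed.

Lemma omul1r u : omul u oone = u.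
Proof. by rewrite /oone; oct_coords u; oct_ring. Qed.

Lemma oconjK u : oconj (oconj u) = u.
Proof. by oct_coords u; oct_ring. Qed.

Lemma oconj1 : oconj oone = oone.
Proof. by rewrite /oone; oct_ring. Qed.

Lemma oconjM u v : oconj (omul u v) = omul (oconj v) (oconj u).
Proof. by oct_coords u; oct_coords v; oct_ring. Qed.

Lemma oconjD u v : oconj (u + v) = oconj u + oconj v.
Proof. by oct_coords u; oct_coords v; oct_ring. Qed.

Lemma oconjZ a u : oconj (a *: u) = a *: oconj u.
Proof. by oct_coords u; oct_ring. Qed.

Lemma oconj_imag u : ore u = 0 -> oconj u = - u.
Proof.
oct_coords u; rewrite ore_mkoct => ->; oct_ring.
Qed.

Lemma odotDl u v w : odot (u + v) w = odot u w + odot v w.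
Proof. by rewrite /odot omulDl /ore /ocomp mxE. Qed.

Lemma odotZl a u w : odot (a *: u) w = a * odot u w.
Proof. by rewrite /odot omulZl /ore /ocomp mxE. Qed.

Lemma odotC u v : odot u v = odot v u.
Proof.
oct_coords u; oct_coords v; oct_simpl.
by rewrite ?odot_mkoct ?ore_mkoct; ring.
Qed.

Lemma odot1 w : odot oone w = ore w.
Proof.
by oct_coords w; rewrite /oone odot_mkoct ore_mkoct; ring.
Qed.

Lemma odotMl u v : odot (omul u v) v = ore u * odot v v.
Proof.
oct_coords u; oct_coords v; oct_simpl.
by rewrite ?odot_mkoct ?ore_mkoct; ring.
Qed.

(** Polarisation of [u (conj u w) = |u|^2 w]. For orthogonal [u] and [v] the right-hand side
    vanishes, so the two outer factors can be exchanged at the cost of a sign. *)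
Lemma omul_conj_polar u v w :
  omul u (omul (oconj v) w) + omul v (omul (oconj u) w) = (odot u v *+ 2) *: w.
Proof.
oct_coords u; oct_coords v; oct_coords w.
by rewrite odot_mkoct; oct_ring.
Qed.

Lemma omul_conj_polar_r u v w :
  omul (omul w (oconj u)) v + omul (omul w (oconj v)) u = (odot u v *+ 2) *: w.
Proof.
(* Conjugation reverses products and so turns the left identity into the right one; it remains that
   it preserves [odot]. *)
have := congr1 (@oconj R) (omul_conj_polar (oconj u) (oconj v) (oconj w)).
rewrite oconjD oconjZ !oconjM !oconjK addrC => ->; congr (_ *+ 2 *: _).
oct_coords u; oct_coords v; oct_simpl.
by rewrite ?odot_mkoct ?ore_mkoct; ring.
Qed.

Lemma omul_conjK u w : omul u (omul (oconj u) w) = odot u u *: w.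
Proof.
oct_coords u; oct_coords w.
by rewrite odot_mkoct; oct_ring.
Qed.

(** The middle Moufang identity, used in [doubling] for the product of the two terms that contain
    [w]. *)
Lemma moufang_middle u v w :
  omul (omul w u) (omul v w) = omul w (omul (omul u v) w).
Proof. by oct_coords u; oct_coords v; oct_coords w; oct_ring. Qed.

Lemma omul_comm_conj q w : oconj w = - w -> odot q w = 0 ->
  omul q w = omul w (oconj q).
Proof.
move=> w_im qw0; have := omul_conj_polar q w oone.
rewrite qw0 mul0rn scale0r !omul1r w_im omulNr => /eqP.
by rewrite addrC subr_eq0 => /eqP.
Qed.

(** Inside the octonions, an imaginary [w] orthogonal to the factors acts as the new unit of a
    Cayley-Dickson doubling, with square [- odot w w]. The last two hypotheses concern products;
    they hold when the factors range over a conjugation-stable subalgebra orthogonal to [w]. *)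
Lemma doubling p q r s w : oconj w = - w ->
    odot p w = 0 -> odot q w = 0 -> odot r w = 0 -> odot s w = 0 ->
    odot (omul s p) w = 0 -> odot (omul (oconj q) s) w = 0 ->
  omul (p + omul q w) (r + omul s w) =
  (omul p r - odot w w *: omul (oconj s) q)
  + omul (omul s p + omul q (oconj r)) w.
Proof.
move=> w_im pw qw rw sw spw qsw.
have psw : omul p (omul s w) = omul (omul s p) w.
  rewrite (omul_comm_conj w_im sw) (omul_comm_conj w_im spw) oconjM.
  have := omul_conj_polar p w (oconj s).
  rewrite pw mul0rn scale0r w_im omulNl omulNr => /eqP.
  by rewrite addrC subr_eq0 => /eqP.
have qwr : omul (omul q w) r = omul (omul q (oconj r)) w.
  have := omul_conj_polar_r r w q.
  rewrite rw mul0rn scale0r w_im omulNr omulNl => /eqP.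
  by rewrite subr_eq0 => /eqP.
(* Moving [w] to the front of the first factor gives the Moufang shape; the two copies of [w] then
   meet and contribute [- odot w w]. *)
have qwsw : omul (omul q w) (omul s w) = - (odot w w *: omul (oconj s) q).
  rewrite (omul_comm_conj w_im qw) moufang_middle (omul_comm_conj w_im qsw).
  rewrite oconjM oconjK -(omul_conjK w (omul (oconj s) q)) w_im.
  by rewrite omulNl omulNr opprK.
rewrite omulDl !omulDr psw qwr qwsw omulDl -!addrA; congr (_ + _).
by rewrite addrA addrC.
Qed.

End Orthogonality.

(** * Orthogonal coordinate systems *)

Section CayleyDickson.
Variable R : comNzRingType.

(* The algebra obtained from [R] by three Cayley-Dickson doublings with squares
   [- al], [- be], [- ga], in the coordinate order of [oct]. *)
Definition cdmul (al be ga : R) (u w : oct R) : oct R :=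
  let a := ocomp u in let b := ocomp w in
  mkoct
   [:: a 0 * b 0 - al * a 1 * b 1 - be * a 2 * b 2 - al * be * a 3 * b 3
         - al * be * ga * a 4 * b 4 - be * ga * a 5 * b 5 - al * ga * a 6 * b 6
         - ga * a 7 * b 7;
       a 0 * b 1 + a 1 * b 0 + be * a 2 * b 3 - be * a 3 * b 2
         + be * ga * a 4 * b 5 - be * ga * a 5 * b 4 - ga * a 6 * b 7
         + ga * a 7 * b 6;
       a 0 * b 2 - al * a 1 * b 3 + a 2 * b 0 + al * a 3 * b 1
         - al * ga * a 4 * b 6 - ga * a 5 * b 7 + al * ga * a 6 * b 4
         + ga * a 7 * b 5;
       a 0 * b 3 + a 1 * b 2 - a 2 * b 1 + a 3 * b 0 - ga * a 4 * b 7
         + ga * a 5 * b 6 - ga * a 6 * b 5 + ga * a 7 * b 4;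
       a 0 * b 4 - a 1 * b 5 + a 2 * b 6 + a 3 * b 7 + a 4 * b 0 + a 5 * b 1
         - a 6 * b 2 - a 7 * b 3;
       a 0 * b 5 + al * a 1 * b 4 + a 2 * b 7 - al * a 3 * b 6
         - al * a 4 * b 1 + a 5 * b 0 + al * a 6 * b 3 - a 7 * b 2;
       a 0 * b 6 + a 1 * b 7 - be * a 2 * b 4 + be * a 3 * b 5
         + be * a 4 * b 2 - be * a 5 * b 3 + a 6 * b 0 - a 7 * b 1;
       a 0 * b 7 - al * a 1 * b 6 - be * a 2 * b 5 - al * be * a 3 * b 4
         + al * be * a 4 * b 3 + be * a 5 * b 2 + al * a 6 * b 1 + a 7 * b 0].

Lemma cdmulE (al be ga a0 a1 a2 a3 a4 a5 a6 a7 b0 b1 b2 b3 b4 b5 b6 b7 : R) :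
  cdmul al be ga (mkoct [:: a0; a1; a2; a3; a4; a5; a6; a7])
                 (mkoct [:: b0; b1; b2; b3; b4; b5; b6; b7]) =
  mkoct
   [:: a0 * b0 - al * a1 * b1 - be * a2 * b2 - al * be * a3 * b3
         - al * be * ga * a4 * b4 - be * ga * a5 * b5 - al * ga * a6 * b6
         - ga * a7 * b7;
       a0 * b1 + a1 * b0 + be * a2 * b3 - be * a3 * b2 + be * ga * a4 * b5
         - be * ga * a5 * b4 - ga * a6 * b7 + ga * a7 * b6;
       a0 * b2 - al * a1 * b3 + a2 * b0 + al * a3 * b1 - al * ga * a4 * b6
         - ga * a5 * b7 + al * ga * a6 * b4 + ga * a7 * b5;
       a0 * b3 + a1 * b2 - a2 * b1 + a3 * b0 - ga * a4 * b7 + ga * a5 * b6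
         - ga * a6 * b5 + ga * a7 * b4;
       a0 * b4 - a1 * b5 + a2 * b6 + a3 * b7 + a4 * b0 + a5 * b1 - a6 * b2
         - a7 * b3;
       a0 * b5 + al * a1 * b4 + a2 * b7 - al * a3 * b6 - al * a4 * b1
         + a5 * b0 + al * a6 * b3 - a7 * b2;
       a0 * b6 + a1 * b7 - be * a2 * b4 + be * a3 * b5 + be * a4 * b2
         - be * a5 * b3 + a6 * b0 - a7 * b1;
       a0 * b7 - al * a1 * b6 - be * a2 * b5 - al * be * a3 * b4
         + al * be * a4 * b3 + be * a5 * b2 + al * a6 * b1 + a7 * b0].
Proof. by rewrite /cdmul !ocomp_mkoct. Qed.

Variables e1 e2 e4 : oct R.

(** [cd1] and [cd2] are the general elements reached after one and two doublings, in the spans of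
    [1, e1] and of [1, e1, e2, e1 e2]. *)
Definition cd1 (a0 a1 : R) : oct R := a0 *: oone R + a1 *: e1.

Definition cd2 (a0 a1 a2 a3 : R) : oct R := cd1 a0 a1 + omul (cd1 a2 a3) e2.

Definition cd_basis : 'M[R]_8 :=
  \matrix_(k < 8) nth 0 [:: oone R; e1; e2; omul e1 e2; omul (omul e1 e2) e4;
                            omul e2 e4; omul e1 e4; e4] k.

Lemma cd_basisE (a0 a1 a2 a3 a4 a5 a6 a7 : R) :
  mkoct [:: a0; a1; a2; a3; a4; a5; a6; a7] *m cd_basis =
  cd2 a0 a1 a2 a3 + omul (cd2 a7 a6 a5 a4) e4.
Proof.
rewrite mulmx_sum_row !big_ord_recl big_ord0 !rowK !mxE /=.
rewrite /cd2 /cd1 !(omulDl, omulZl, omul1l) addr0 -!addrA.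
(* Coordinates 4 to 7 of [oct] list the second quaternion backwards, hence the reversal. *)
by do 4!congr (_ + _); rewrite !addrA (ACl (4 * 3 * 2 * 1)).
Qed.

Lemma cd1D a b c d : cd1 a b + cd1 c d = cd1 (a + c) (b + d).
Proof. by rewrite /cd1 !scalerDl addrACA. Qed.

Lemma cd1Z k a b : k *: cd1 a b = cd1 (k * a) (k * b).
Proof. by rewrite /cd1 scalerDr !scalerA. Qed.

Lemma cd2D a b c d a' b' c' d' :
  cd2 a b c d + cd2 a' b' c' d' = cd2 (a + a') (b + b') (c + c') (d + d').
Proof. by rewrite /cd2 -!cd1D omulDl addrACA. Qed.

Lemma cd2Z k a b c d : k *: cd2 a b c d = cd2 (k * a) (k * b) (k * c) (k * d).
Proof. by rewrite /cd2 -!cd1Z omulZl scalerDr. Qed.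

Hypotheses (e1_im : ore e1 = 0) (e2_im : ore e2 = 0) (e4_im : ore e4 = 0).
Hypotheses (e12 : odot e1 e2 = 0) (e14 : odot e1 e4 = 0) (e24 : odot e2 e4 = 0).
Hypothesis e124 : odot (omul e1 e2) e4 = 0.

Lemma cd1_orth2 a b : odot (cd1 a b) e2 = 0.
Proof. by rewrite odotDl !odotZl odot1 e2_im e12 !mulr0 addr0. Qed.

Lemma cd2_orth4 a b c d : odot (cd2 a b c d) e4 = 0.
Proof.
rewrite /cd2 /cd1 !(omulDl, omulZl, omul1l, odotDl, odotZl, odot1).
by rewrite e4_im e14 e24 e124 !mulr0 !addr0.
Qed.

Lemma cd1_conj a b : oconj (cd1 a b) = cd1 a (- b).
Proof.
by rewrite /cd1 oconjD !oconjZ oconj1 (oconj_imag e1_im) scalerN scaleNr.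
Qed.

Lemma cd2_conj a b c d : oconj (cd2 a b c d) = cd2 a (- b) (- c) (- d).
Proof.
rewrite oconjD (omul_comm_conj (oconj_imag e2_im) (cd1_orth2 _ _)) oconjM.
rewrite oconjK cd1_conj (oconj_imag e2_im) omulNr -omulNl -[- cd1 c d]scaleN1r.
by rewrite cd1Z !mulN1r.
Qed.

(** All basis vectors other than [1] are imaginary, so conjugation looks the same in the new
    coordinates. *)
Lemma cd3_conj u : oconj (u *m cd_basis) = oconj u *m cd_basis.
Proof.
oct_coords u; oct_simpl; rewrite !cd_basisE.
rewrite oconjD (omul_comm_conj (oconj_imag e4_im) (cd2_orth4 _ _ _ _)) oconjM.
rewrite oconjK cd2_conj (oconj_imag e4_im) omulNr -omulNl -[- cd2 _ _ _ _]scaleN1r.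
by rewrite cd2Z !mulN1r.
Qed.

Lemma cd1M a b c d :
  omul (cd1 a b) (cd1 c d) = cd1 (a * c - odot e1 e1 * b * d) (a * d + b * c).
Proof.
have e11 : omul e1 e1 = - (odot e1 e1 *: oone R).
  by rewrite -omul_conjK omul1r (oconj_imag e1_im) omulNr opprK.
rewrite /cd1 !(omulDl, omulDr, omulZl, omulZr, omul1l, omul1r) e11.
rewrite !(scalerDr, scalerN, scalerA) -scaleNr [X in _ + X]addrC addrACA -!scalerDl.
by congr (_ *: _ + _ *: _); ring.
Qed.

Lemma cd2M a b c d a' b' c' d' :
  let al := odot e1 e1 in let be := odot e2 e2 in
  omul (cd2 a b c d) (cd2 a' b' c' d') =
  cd2 (a * a' - al * b * b' - be * c * c' - al * be * d * d')
      (a * b' + b * a' + be * c * d' - be * d * c')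
      (a * c' - al * b * d' + c * a' + al * d * b')
      (a * d' + b * c' - c * b' + d * a').
Proof.
move=> al be; rewrite [LHS]doubling ?(cd1M, cd1_conj) ?cd1_orth2 //; last first.
  exact: oconj_imag.
rewrite -[- (_ *: _)]scaleNr !cd1Z !cd1D.
by congr (cd1 _ _ + omul (cd1 _ _) _); rewrite -/al -/be; ring.
Qed.

(** The third doubling, by [e4]. Invertibility of the basis enters only later, with positivity of
    the three norms. *)
Lemma cd_basisM u w :
  omul (u *m cd_basis) (w *m cd_basis) =
  cdmul (odot e1 e1) (odot e2 e2) (odot e4 e4) u w *m cd_basis.
Proof.
oct_coords u; oct_coords w; rewrite cdmulE !cd_basisE.
rewrite doubling ?(cd2M, cd2_conj) ?cd2_orth4 //; last exact: oconj_imag.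
rewrite -[- (_ *: _)]scaleNr !cd2Z !cd2D.
by congr (cd2 _ _ _ _ + omul (cd2 _ _ _ _) _); ring.
Qed.

End CayleyDickson.

(** * The eigenvector equation in coordinates *)

Ltac cd_simpl :=
  oct_simpl;
  repeat (match goal with
  | |- context [cdmul ?al ?be ?ga (mkoct ?s) (mkoct ?t)] =>
      rewrite [cdmul al be ga (mkoct s) (mkoct t)]cdmulE
  end; oct_simpl).

Lemma mkoct_inj (R : comNzRingType)
    (a0 a1 a2 a3 a4 a5 a6 a7 b0 b1 b2 b3 b4 b5 b6 b7 : R) :
  mkoct [:: a0; a1; a2; a3; a4; a5; a6; a7] =
  mkoct [:: b0; b1; b2; b3; b4; b5; b6; b7] ->
  [/\ a0 = b0, a1 = b1, a2 = b2 & a3 = b3] /\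
  [/\ a4 = b4, a5 = b5, a6 = b6 & a7 = b7].
Proof.
move=> e; have {}e k := congr1 (fun u => ocomp u k) e.
move: (e 0%N) (e 1%N) (e 2) (e 3) (e 4) (e 5) (e 6) (e 7).
by rewrite !ocomp_mkoct.
Qed.

Section CoordinateSystem.
Variable R : realFieldType.
Variables al be ga y2 z2 z3 z4 : R.
Hypotheses (al_gt0 : 0 < al) (be_gt0 : 0 < be) (ga_gt0 : 0 < ga).

Local Notation "u ** w" := (cdmul al be ga u w) (at level 40).

(** Coordinates of [x], [y], [z] and of their associator [2 (x e2) e4] in the orthogonal system. *)
Definition cdX : oct R := mkoct [:: 0; 1; 0; 0; 0; 0; 0; 0].
Definition cdY : oct R := mkoct [:: 0; y2; 1; 0; 0; 0; 0; 0].
Definition cdZ : oct R := mkoct [:: 0; z2; z3; z4; 0; 0; 0; 1].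
Definition cdT : oct R := mkoct [:: 0; 0; 0; 0; 2; 0; 0; 0].

Lemma cd_assocE : (cdX ** cdY) ** cdZ - cdX ** (cdY ** cdZ) = cdT.
Proof.
rewrite /cdX /cdY /cdZ /cdT; cd_simpl.
by congr (mkoct [:: _; _; _; _; _; _; _; _]); ring.
Qed.

(** [cdmul] is right alternative and [cdX] squares to [- al]. *)
Lemma cdmulKX u : (u ** cdX) ** cdX = - (al *: u).
Proof.
rewrite /cdX; oct_coords u; cd_simpl.
by congr (mkoct [:: _; _; _; _; _; _; _; _]); ring.
Qed.

Lemma cdmulX_eq u w : u ** cdX = w <-> u = - al^-1 *: (w ** cdX).
Proof.
have al0 : al != 0 by exact: lt0r_neq0.
split=> [<-|->].
  by rewrite cdmulKX scalerN scaleNr opprK scalerA mulVf ?scale1r.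
rewrite -[RHS]scale1r -(mulVf al0) -scalerA.
rewrite -[al *: w]opprK -cdmulKX; move: (w ** cdX) => v.
rewrite /cdX; oct_coords v; cd_simpl.
by congr (mkoct [:: _; _; _; _; _; _; _; _]); ring.
Qed.

(** [sol_a] and [sol_c] solve the second and third rows by [cdmulX_eq]; the second row contains
    [conj a], hence the outer conjugation. *)
Definition sol_a (m : R) (b : oct R) : oct R :=
  oconj (- al^-1 *: ((cdY ** cdT - (m *: cdY + b ** cdZ)) ** cdX)).

Definition sol_c (n : R) (b : oct R) : oct R :=
  - al^-1 *: ((cdZ ** cdT - (oconj b ** cdY + n *: cdZ)) ** cdX).

Definition sol_b (p m n b0 b3 b6 : R) : oct R :=
  let k := al - al * be * z4 ^+ 2 + al * y2 ^+ 2 + al * z2 ^+ 2 - be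
           - be * z3 ^+ 2 - ga in
  let b2 := - al * z4 * b6 + 2 * al * (y2 + z2 * z3) in
  let b5 := (2 * al * y2 * z2 * b0 + 2 * be * z3 * b0 - 2 * al * be * z4 * k
             + 2 * al * be * y2 * z4 * b2 - 2 * al * be * y2 * z3 * b3
             + 2 * al * be * z2 * b3 - 2 * al * ga * y2 * b6
             + n * (al * be * z4 ^+ 2 + al * z2 ^+ 2 + be * z3 ^+ 2 + ga)
             + m * (al * y2 ^+ 2 + be) - al * p)
            / (2 * be * (ga + al * be * z4 ^+ 2)) in
  mkoct [:: b0; be * z4 * b5 + k; b2; b3; 0; b5; b6; 2 * al * z2].

(** Linear elimination by certificate: once the multiplier [k] is named, only an identity for [ring]
    or [field] remains. *)
Lemma lin_comb (k l r x y : R) : l = r -> x - y = k * (l - r) -> x = y.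
Proof. by move=> ->; rewrite subrr mulr0 => /subr0_eq. Qed.

(** Pulling out [al^-1] keeps the coordinates polynomial, here and in the next two lemmas. *)
Lemma sol_aE m b0 b1 b2 b3 b4 b5 b6 b7 :
  sol_a m (mkoct [:: b0; b1; b2; b3; b4; b5; b6; b7]) = al^-1 *: mkoct
   [:: - al * b0 * z2 - al * b2 * be * z4 + al * b3 * be * z3
         + al * b6 * ga - al * m * y2;
       al * b1 * z2 + b2 * be * z3 + al * b3 * be * z4 + b7 * ga;
       - al * b0 * z4 - al * b1 * z3 + al * b2 * z2 + al * b4 * ga;
       b0 * z3 - al * b1 * z4 + al * b3 * z2 - b5 * ga + m;
       2 * al * y2 - b2 + al * b4 * z2 - al * b6 * z4 + b7 * z3;
       al * b3 + al * b5 * z2 - al * b6 * z3 - al * b7 * z4;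
       b0 + al * b4 * be * z4 + b5 * be * z3 + al * b6 * z2;
       - 2 * al * be - al * b1 - al * b4 * be * z3 + al * b5 * be * z4
         + al * b7 * z2].
Proof.
rewrite /sol_a /cdX /cdY /cdZ /cdT; cd_simpl.
by congr (mkoct [:: _; _; _; _; _; _; _; _]); ring.
Qed.

Lemma sol_cE n b0 b1 b2 b3 b4 b5 b6 b7 :
  sol_c n (mkoct [:: b0; b1; b2; b3; b4; b5; b6; b7]) = al^-1 *: mkoct
   [:: - al * b0 * y2 - al * b3 * be - al * n * z2;
       al * b1 * y2 + b2 * be;
       - 2 * al * ga - al * b1 + al * b2 * y2 + al * n * z4;
       - b0 + al * b3 * y2 - n * z3;
       - 2 * al * z2 + al * b4 * y2 + b7;
       al * b5 * y2 - al * b6;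
       - 2 * al * be * z4 + b5 * be + al * b6 * y2 - n;
       2 * al * be * z3 - al * b4 * be + al * b7 * y2].
Proof.
rewrite /sol_c /cdX /cdY /cdZ /cdT; cd_simpl.
by congr (mkoct [:: _; _; _; _; _; _; _; _]); ring.
Qed.

(** The first row with [a] and [c] eliminated. Coordinate 2 vanishes identically, and coordinates 4
    and 7 are multiples of coordinates 0 and 3. Five equations remain, for [b1], [b2], [b4], [b5],
    [b7], which leaves [27 - 16 - 5 = 6] parameters. *)
Lemma cd_residualE p m n b0 b1 b2 b3 b4 b5 b6 b7
    (b := mkoct [:: b0; b1; b2; b3; b4; b5; b6; b7]) :
  p *: cdX + sol_a m b ** cdY + oconj (sol_c n b) ** cdZ - cdX ** cdT =
  al^-1 *: mkoct
   [:: - 2 * al * b4 * be * ga;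
       - 2 * al * b0 * y2 * z2 - 2 * b0 * be * z3 + 2 * al * b1 * be * z4
         - 2 * al * b2 * be * y2 * z4 + 2 * al * b3 * be * y2 * z3
         - 2 * al * b3 * be * z2 + 2 * b5 * be * ga + 2 * al * b6 * ga * y2
         - al * m * y2 ^+ 2 - be * m - al * be * n * z4 ^+ 2
         - al * n * z2 ^+ 2 - be * n * z3 ^+ 2 - ga * n + al * p;
       0;
       - 4 * al * ga * z2 + 2 * b7 * ga;
       - 2 * al * b4 * be * z4;
       - 2 * al ^+ 2 + 2 * al ^+ 2 * be * z4 ^+ 2 - 2 * al ^+ 2 * y2 ^+ 2
         - 2 * al ^+ 2 * z2 ^+ 2 + 2 * al * be + 2 * al * be * z3 ^+ 2
         + 2 * al * ga + 2 * al * b1 - 2 * al * b5 * be * z4;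
       4 * al * be * y2 + 4 * al * be * z2 * z3 - 2 * b2 * be
         - 2 * al * b6 * be * z4;
       4 * al ^+ 2 * be * z2 * z4 - 2 * al * b7 * be * z4].
Proof.
have al0 : al != 0 by exact: lt0r_neq0.
rewrite sol_aE sol_cE /cdX /cdY /cdZ /cdT; cd_simpl.
by congr (mkoct [:: _; _; _; _; _; _; _; _]); field.
Qed.

Lemma cd_eigen_reduced p m n b :
  p *: cdX + sol_a m b ** cdY + oconj (sol_c n b) ** cdZ = cdX ** cdT <->
  b = sol_b p m n (ocomp b 0) (ocomp b 3) (ocomp b 6).
Proof.
have al0 : al != 0 by exact: lt0r_neq0.
have be0 : be != 0 by exact: lt0r_neq0.
have ga0 : ga != 0 by exact: lt0r_neq0.
have D0 : ga + al * be * z4 ^+ 2 != 0.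
  by rewrite lt0r_neq0 // ltr_wpDr // mulr_ge0 ?sqr_ge0 // ltW // mulr_gt0.
have eqB (u w : oct R) : u = w <-> u - w = 0.
  by split=> [->|/subr0_eq//]; rewrite subrr.
apply: iff_trans (eqB _ _) _ => {eqB}.
have [b0 [b1 [b2 [b3 [b4 [b5 [b6 [b7 ->]]]]]]]] := octP b.
rewrite cd_residualE !ocomp_mkoct //= /sol_b.
(* Zero gets the same factor [al^-1], which can then be cancelled. *)
have -> : 0 = al^-1 *: mkoct [:: 0; 0; 0; 0; 0; 0; 0; 0] :> oct R.
  oct_simpl; apply/rowP => -[[|[|[|[|[|[|[|[|//]]]]]]]] k8];
  by rewrite !mxE /= mulr0.
split.
  move/(scalerI (invr_neq0 al0)).
  move/mkoct_inj=> [[e0 e1 e2 e3] [e4 e5 e6 e7]].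
  (* The system is triangular: [b4], [b7], [b2] first, then [b1] in terms of [b5], and [b5] last,
     from coordinate 1. *)
  have {e0} h4 : b4 = 0.
    apply: (lin_comb (k := - (2 * al * be * ga)^-1) e0); field.
    by rewrite al0 be0 ga0.
  have {e3} h7 : b7 = 2 * al * z2.
    by apply: (lin_comb (k := 1 / (2 * ga)) e3); field.
  have {e6} h2 : b2 = - al * z4 * b6 + 2 * al * (y2 + z2 * z3).
    apply: (lin_comb (k := - 1 / (2 * be)) e6); field.
    by rewrite be0.
  subst b4 b7 b2.
  have {e5} h1 : b1 = be * z4 * b5 + (al - al * be * z4 ^+ 2 + al * y2 ^+ 2
      + al * z2 ^+ 2 - be - be * z3 ^+ 2 - ga).
    apply: (lin_comb (k := 1 / (2 * al)) e5); field.
    by rewrite al0.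
  subst b1.
  (* [b5] enters coordinates 1 and 5; both goals follow from [e1], where its coefficient is now
     [2 be (ga + al be z4^2)]. *)
  congr (mkoct [:: _; _ * _ + _; _; _; _; _; _; _]);
    apply: (lin_comb (k := 1 / (2 * be * (ga + al * be * z4 ^+ 2))) e1); field;
    by rewrite be0 D0.
move/mkoct_inj=> [[_ -> -> _] [-> -> _ ->]]; congr (_ *: _).
by congr (mkoct [:: _; _; _; _; _; _; _; _]); field; rewrite ?be0 ?D0.
Qed.

End CoordinateSystem.

Section Solutions.
Variable R : realFieldType.
Variables al be ga y2 z2 z3 z4 : R.
Hypotheses (al_gt0 : 0 < al) (be_gt0 : 0 < be) (ga_gt0 : 0 < ga).
Local Notation "u ** w" := (cdmul al be ga u w) (at level 40).
Local Notation X := (cdX R).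
Local Notation Y := (cdY y2).
Local Notation Z := (cdZ z2 z3 z4).
Local Notation T := (cdT R).

Lemma cd_eigenE p m n (a b c : oct R) :
  [/\ p *: X + a ** Y + oconj c ** Z = X ** T,
      oconj a ** X + m *: Y + b ** Z = Y ** T &
      c ** X + oconj b ** Y + n *: Z = Z ** T] <->
  [/\ a = sol_a al be ga y2 z2 z3 z4 m b,
      c = sol_c al be ga y2 z2 z3 z4 n b &
      b = sol_b al be ga y2 z2 z3 z4 p m n (ocomp b 0) (ocomp b 3) (ocomp b 6)].
Proof.
have eqB (u v w : oct R) : u + v = w <-> u = w - v.
  by split=> [<-|->]; rewrite ?addrK ?subrK.
have conjE (u w : oct R) : oconj u = w <-> u = oconj w.
  by split=> [<-|->]; rewrite oconjK.
split=> [[e1]|[-> -> e]].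
  rewrite -!addrA => /eqB/cdmulX_eq - /(_ al_gt0) /conjE ea.
  move=> /eqB/cdmulX_eq - /(_ al_gt0) ec.
  by split=> //; apply/cd_eigen_reduced => //; rewrite /sol_a /sol_c -ea -ec.
rewrite -!addrA; split; first by rewrite addrA; apply/cd_eigen_reduced.
  by apply/eqB/cdmulX_eq => //; rewrite oconjK.
by apply/eqB/cdmulX_eq.
Qed.

End Solutions.

(** * Positivity of the norm and Gram-Schmidt frames *)

Section Frame.
Variable R : realFieldType.
Implicit Types u v w : oct R.

Lemma omul0l u : omul 0 u = 0.
Proof. by rewrite -(scale0r 0) omulZl !scale0r. Qed.

Lemma omul0r u : omul u 0 = 0.
Proof. by rewrite -(scale0r 0) omulZr !scale0r. Qed.

Lemma mkoct0 : mkoct [:: 0; 0; 0; 0; 0; 0; 0; 0] = 0 :> oct R.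
Proof. by apply/rowP => -[[|[|[|[|[|[|[|[|//]]]]]]]] k8]; rewrite !mxE. Qed.

(** The norm form of [cdmul] (see [cdmul_conj]) is a sum of squares with positive weights, hence
    anisotropic. *)
Lemma wnorm_eq0 (al be ga : R) (a0 a1 a2 a3 a4 a5 a6 a7 : R) :
  0 < al -> 0 < be -> 0 < ga ->
  a0 ^+ 2 + al * a1 ^+ 2 + be * a2 ^+ 2 + al * be * a3 ^+ 2
  + al * be * ga * a4 ^+ 2 + be * ga * a5 ^+ 2 + al * ga * a6 ^+ 2
  + ga * a7 ^+ 2 = 0 ->
  mkoct [:: a0; a1; a2; a3; a4; a5; a6; a7] = 0.
Proof.
move=> al0 be0 ga0 /eqP.
have sq_ge0 (c d : R) : 0 < c -> 0 <= c * d ^+ 2.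
  by move=> c0; rewrite mulr_ge0 ?sqr_ge0 // ltW.
rewrite !paddr_eq0 ?addr_ge0 ?sqr_ge0 ?sq_ge0 ?mulr_gt0 //.
rewrite !mulf_eq0 !orbb (gt_eqF al0) (gt_eqF be0) (gt_eqF ga0) /= => e.
move: e; rewrite -!andbA => /and5P[/eqP-> /eqP-> /eqP-> /eqP->].
by case/and4P=> /eqP-> /eqP-> /eqP-> /eqP->; rewrite mkoct0.
Qed.

Lemma odot_gt0 u : u != 0 -> 0 < odot u u.
Proof.
oct_coords u; apply: contraNT; rewrite odot_mkoct -leNgt => le0; apply/eqP.
apply: (@wnorm_eq0 1 1 1) => //; apply/le_anti/andP; split.
  by apply: le_trans le0; rewrite !mulr1 !mul1r !expr2.
by rewrite !mulr1 !mul1r !addr_ge0 ?sqr_ge0.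
Qed.

Lemma odotBl u v w : odot (u - v) w = odot u w - odot v w.
Proof. by rewrite odotDl -scaleN1r odotZl mulN1r. Qed.

Lemma odot0l w : odot 0 w = 0.
Proof. by rewrite -(scale0r 0) odotZl mul0r. Qed.

(** This covers [w = 0], where division by zero yields 0, so Gram-Schmidt can run before
    independence is known. *)
Lemma odot_proj u w : odot (u - (odot u w / odot w w) *: w) w = 0.
Proof.
rewrite odotBl odotZl; have [->|w0] := eqVneq w 0.
  by rewrite odotC odot0l !mul0r subrr.
by rewrite divfK ?subrr // gt_eqF // odot_gt0.
Qed.

Lemma odotMr u v : odot (omul u v) u = ore v * odot u u.
Proof.
by oct_coords u; oct_coords v; oct_simpl; rewrite !odot_mkoct ore_mkoct; ring.
Qed.

Lemma oreB u v : ore (u - v) = ore u - ore v.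
Proof. by rewrite /ore /ocomp !mxE. Qed.

Lemma oreZ a u : ore (a *: u) = a * ore u.
Proof. by rewrite /ore /ocomp !mxE. Qed.

(** The output of Gram-Schmidt. The vectors may vanish here; [frame_gt0] excludes this by means of
    the associator. *)
Definition frame (x y z e2 e4 : oct R) (y2 z2 z3 z4 : R) : Prop :=
  [/\ [/\ ore x = 0, ore e2 = 0 & ore e4 = 0],
      [/\ odot x e2 = 0, odot x e4 = 0, odot e2 e4 = 0 & odot (omul x e2) e4 = 0],
      y = y2 *: x + e2 & z = z2 *: x + z3 *: e2 + z4 *: omul x e2 + e4].

Lemma oreM u v : ore (omul u v) = ore u * ore v *+ 2 - odot u v.
Proof.
by oct_coords u; oct_coords v; oct_simpl; rewrite !(odot_mkoct, ore_mkoct); ring.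
Qed.

Lemma frame_exists x y z : ore x = 0 -> ore y = 0 -> ore z = 0 ->
  exists e2 e4 y2 z2 z3 z4, frame x y z e2 e4 y2 z2 z3 z4.
Proof.
move=> x0 y0 z0; pose e2 := y - (odot y x / odot x x) *: x.
have e2x : odot e2 x = 0 by exact: odot_proj.
have e20 : ore e2 = 0 by rewrite oreB oreZ y0 x0 mulr0 subr0.
(* Since [x] and [e2] are imaginary, [e3] is orthogonal to both, and the successive projections of
   [z] do not disturb each other. *)
pose e3 := omul x e2.
have e32 : odot e3 e2 = 0 by rewrite odotMl x0 mul0r.
have e3x : odot e3 x = 0 by rewrite odotMr e20 mul0r.
have e30 : ore e3 = 0 by rewrite oreM odotC e2x x0 mul0r mul0rn subrr.
pose u := z - (odot z x / odot x x) *: x.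
pose v := u - (odot u e2 / odot e2 e2) *: e2.
pose e4 := v - (odot v e3 / odot e3 e3) *: e3.
have ux : odot u x = 0 by exact: odot_proj.
have ve2 : odot v e2 = 0 by exact: odot_proj.
exists e2, e4, (odot y x / odot x x), (odot z x / odot x x),
  (odot u e2 / odot e2 e2), (odot v e3 / odot e3 e3); split.
- split=> //; rewrite /e4 oreB oreZ e30 mulr0 subr0 /v oreB oreZ e20 mulr0 subr0.
  by rewrite /u oreB oreZ z0 x0 mulr0 subr0.
- split; rewrite odotC //.
  + by rewrite /e4 odotBl odotZl e3x mulr0 subr0 /v odotBl odotZl e2x ux mulr0 subr0.
  + by rewrite /e4 odotBl odotZl e32 ve2 mulr0 subr0.
  + exact: odot_proj.
- by rewrite addrC subrK.
- by rewrite -/e3 -addrA (addrC _ e4) subrK -addrA (addrC _ v) subrK addrC subrK.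
Qed.

End Frame.

(** * Hermitian matrices *)

Section Hermitian.
Variable R : comNzRingType.
Implicit Types (h : 'rV[R]_27) (p m n : R) (a b c : oct R).

Definition mkherm p m n a b c : 'rV[R]_27 :=
  \row_(k < 27) if (k < 3)%N then nth 0 [:: p; m; n] k
                else if (k < 11)%N then a 0 (inord (k - 3))
                else if (k < 19)%N then b 0 (inord (k - 11))
                else c 0 (inord (k - 19)).

Lemma mkhermK p m n a b c (h := mkherm p m n a b c) :
  [/\ hp h = p, hm h = m & hn h = n] /\ [/\ ha h = a, hb h = b & hc h = c].
Proof.
split; split; rewrite /h ?/hp ?/hm ?/hn; do ?by rewrite mxE inordK.
all: apply/rowP => k; have k8 := ltn_ord k; rewrite !mxE inordK /=;
  do ?lia.
all: by rewrite ?addKn ?inord_val ?ifT //; lia.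
Qed.

Lemma herm_ext h h' : hp h = hp h' -> hm h = hm h' -> hn h = hn h' ->
  ha h = ha h' -> hb h = hb h' -> hc h = hc h' -> h = h'.
Proof.
move=> ep em en /rowP ea /rowP eb /rowP ec; apply/rowP => k.
have [k3|k3] := ltnP k 3.
  rewrite -[k]inord_val; case: (nat_of_ord k) k3 => [|[|[|//]]] _;
    [exact: ep|exact: em|exact: en].
have [k11|k11] := ltnP k 11.
  by have := ea (inord (k - 3)); rewrite !mxE inordK ?subnKC ?inord_val //; lia.
have [k19|k19] := ltnP k 19.
  by have := eb (inord (k - 11)); rewrite !mxE inordK ?subnKC ?inord_val //; lia.
have := ec (inord (k - 19)); rewrite !mxE inordK ?subnKC ?inord_val //.
by have := ltn_ord k; lia.
Qed.

Lemma hermP k h h' : [/\ hp (k *: h + h') = k * hp h + hp h',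
  hm (k *: h + h') = k * hm h + hm h' & hn (k *: h + h') = k * hn h + hn h'] /\
  [/\ ha (k *: h + h') = k *: ha h + ha h', hb (k *: h + h') = k *: hb h + hb h' &
   hc (k *: h + h') = k *: hc h + hc h'].
Proof.
by split; split; rewrite /hp /hm /hn; do 1?apply/rowP => i; rewrite !mxE.
Qed.

(** The right-hand sides depend on the vector alone, so each row is an inhomogeneous linear equation
    in [h]. *)
Lemma eigen_affine x y z k h1 h2 h3 :
  eigen_eq h1 x y z -> eigen_eq h2 x y z -> eigen_eq h3 x y z ->
  eigen_eq (h1 + k *: (h2 - h3)) x y z.
Proof.
have lin f : (forall k h h', f (k *: h + h') = k *: f h + f h' :> oct R) ->
    forall t, f h1 = t -> f h2 = t -> f h3 = t -> f (h1 + k *: (h2 - h3)) = t.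
  move=> fl t f1 f2 f3; rewrite addrC fl f1 [h2 - h3]addrC -scaleN1r fl f2 f3.
  by rewrite scaleN1r addNr scaler0 add0r.
have sumZ (u v w u' v' w' : oct R) j : (j *: u + u') + (j *: v + v') + (j *: w + w')
    = j *: (u + v + w) + (u' + v' + w').
  by rewrite !scalerDr !addrA (ACl (1 * 3 * 5 * 2 * 4 * 6)).
move=> [e1 e2 e3] [f1 f2 f3] [g1 g2 g3]; split.
- apply: (lin (fun h =>
    hp h *: x + omul (ha h) y + omul (oconj (hc h)) z)) => // j h h'.
  have [[-> _ _] [-> _ ->]] := hermP j h h'.
  by rewrite oconjD oconjZ scalerDl -scalerA !(omulDl, omulZl) sumZ.
- apply: (lin (fun h =>
    omul (oconj (ha h)) x + hm h *: y + omul (hb h) z)) => // j h h'.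
  have [[_ -> _] [-> -> _]] := hermP j h h'.
  by rewrite oconjD oconjZ scalerDl -scalerA !(omulDl, omulZl) sumZ.
- apply: (lin (fun h =>
    omul (hc h) x + omul (oconj (hb h)) y + hn h *: z)) => // j h h'.
  have [[_ _ ->] [_ -> ->]] := hermP j h h'.
  by rewrite oconjD oconjZ scalerDl -scalerA !(omulDl, omulZl) sumZ.
Qed.

End Hermitian.

(** Take [h0] over [0] and [hs i] over the [i]-th unit vector. The rows [hs i - h0] span the
    direction of [P], and [F] inverts the resulting parametrisation, which forces rank [n]. *)
Lemma affine_chart (R : fieldType) m n (P : 'rV[R]_m -> Prop)
    (F : 'rV[R]_m -> 'rV[R]_n) :
    (forall k h1 h2 h3, P h1 -> P h2 -> P h3 -> P (h1 + k *: (h2 - h3))) ->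
    (forall k h1 h2 h3,
       F (h1 + k *: (h2 - h3)) = F h1 + k *: (F h2 - F h3)) ->
    (forall q, exists! h, P h /\ F h = q) ->
  exists (h0 : 'rV[R]_m) (B : 'M[R]_(n, m)),
    \rank B = n /\ (forall h, P h <-> exists t : 'rV[R]_n, h = h0 + t *m B).
Proof.
move=> Paff Faff chart; have [h0 [[P0 F0] _]] := chart 0.
have /fin_all_exists [hs Hs] (i : 'I_n) :
    exists h, P h /\ F h = delta_mx 0 i.
  by have [h [Hh _]] := chart (delta_mx 0 i); exists h.
pose B := \matrix_i (hs i - h0).
have HB t : P (h0 + t *m B) /\ F (h0 + t *m B) = t.
  rewrite [in X in _ /\ _ = X](row_sum_delta t) mulmx_sum_row.
  (* Both sums grow one unit vector at a time; each step is an affine combination of the current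
     point with [hs i] and [h0]. *)
  elim: (index_enum _) => [|i s [IHP IHF]]; first by rewrite !big_nil addr0.
  rewrite !big_cons rowK addrCA addrC Faff IHF F0 subr0 (Hs i).2 addrC; split.
    by rewrite addrC; apply: Paff => //; exact: (Hs i).1.
  by rewrite addrC.
exists h0, B; split=> [|h].
  apply/eqP/inj_row_free => t tB0.
  by rewrite -(HB t).2 tB0 addr0.
split=> [Ph|[t ->]]; last exact: (HB t).1.
(* [h] and [h0 + F h *m B] both satisfy [P] and have the same image under [F]. *)
exists (F h); have [h' [_ uniq]] := chart (F h).
exact: etrans (esym (uniq h (conj Ph erefl))) (uniq _ (HB (F h))).
Qed.

Lemma cdmul_conj (R : comNzRingType) (al be ga a0 a1 a2 a3 a4 a5 a6 a7 : R)
    (u := mkoct [:: a0; a1; a2; a3; a4; a5; a6; a7]) :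
  cdmul al be ga (oconj u) u =
  (a0 ^+ 2 + al * a1 ^+ 2 + be * a2 ^+ 2 + al * be * a3 ^+ 2
   + al * be * ga * a4 ^+ 2 + be * ga * a5 ^+ 2 + al * ga * a6 ^+ 2
   + ga * a7 ^+ 2) *: oone R.
Proof.
rewrite /u /oone; cd_simpl.
by congr (mkoct [:: _; _; _; _; _; _; _; _]); ring.
Qed.

(** * Transport of the equation to a frame *)

Section Chart.
Variable R : realFieldType.
Variables (x y z e2 e4 : oct R) (y2 z2 z3 z4 : R).
Hypotheses (fr : frame x y z e2 e4 y2 z2 z3 z4) (xyz : oassoc x y z != 0).

Let E := cd_basis x e2 e4.
Let al := odot x x.
Let be := odot e2 e2.
Let ga := odot e4 e4.
Let X := cdX R.
Let Y := cdY y2.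
Let Z := cdZ z2 z3 z4.
Let T := cdT R.

Lemma frame_mul u w : omul (u *m E) (w *m E) = cdmul al be ga u w *m E.
Proof. by case: fr => [[x0 e20 e40] [? ? ? ?] _ _]; exact: cd_basisM. Qed.

Lemma frame_conj u : oconj (u *m E) = oconj u *m E.
Proof. by case: fr => [[x0 e20 e40] [? ? ? ?] _ _]; exact: cd3_conj. Qed.

Let cd_simp := (scale0r, scale1r, add0r, addr0, omul0l, omul1l).

Lemma frame_x : x = X *m E.
Proof. by rewrite cd_basisE /cd2 /cd1 !cd_simp. Qed.

Lemma frame_y : y = Y *m E.
Proof. by case: fr => _ _ -> _; rewrite cd_basisE /cd2 /cd1 !cd_simp. Qed.

Lemma frame_z : z = Z *m E.
Proof.
case: fr => _ _ _ ->; rewrite cd_basisE /cd2 /cd1 !cd_simp.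
by rewrite omulDl !omulZl omul1l addrA.
Qed.

Lemma frame_assoc : oassoc x y z = T *m E.
Proof.
by rewrite /oassoc {1 2}frame_x frame_y frame_z !frame_mul -mulmxBl cd_assocE.
Qed.

(** If [x], [e2] or [e4] vanished, so would [(x e2) e4], and with it the associator. *)
Lemma frame_gt0 : [/\ 0 < al, 0 < be & 0 < ga].
Proof.
have t0 : omul (omul x e2) e4 != 0.
  apply: contraNneq xyz => t0.
  by rewrite frame_assoc cd_basisE /cd2 /cd1 !cd_simp !omulZl t0 scaler0.
split; apply: odot_gt0; apply: contraNneq t0 => ->.
- by rewrite !omul0l.
- by rewrite omul0r omul0l.
- by rewrite omul0r.
Qed.

Lemma frame_unit : E \in unitmx.
Proof.
have [al0 be0 ga0] := frame_gt0.
rewrite -row_free_unit; apply: inj_row_free => u uE0.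
(* The product of the conjugate of [u] with [u] is the weighted norm times [1]; its image under [E]
   is zero, so the norm is zero. *)
have := frame_mul (oconj u) u; rewrite uE0 omul0r; move: uE0.
oct_coords u; move=> _; rewrite cdmul_conj -scalemxAl /oone cd_basisE /cd2 /cd1.
rewrite !cd_simp => /esym/(congr1 (@ore R)); rewrite oreZ ore_mkoct mulr1.
rewrite [ore 0]mxE; exact: wnorm_eq0.
Qed.

Lemma frame_eigen h (c := fun w : oct R => w *m invmx E) :
  let a := c (ha h) in let b := c (hb h) in let d := c (hc h) in
  eigen_eq h x y z <->
  [/\ a = sol_a al be ga y2 z2 z3 z4 (hm h) b,
      d = sol_c al be ga y2 z2 z3 z4 (hn h) b &
      b = sol_b al be ga y2 z2 z3 z4 (hp h) (hm h) (hn h)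
            (ocomp b 0) (ocomp b 3) (ocomp b 6)].
Proof.
have [al0 be0 ga0] := frame_gt0.
move=> a b d; apply: iff_trans (cd_eigenE _ _ _ _ al0 be0 ga0 _ _ _ a b d).
have cE w : w = c w *m E by rewrite mulmxKV ?frame_unit.
have inj (u w : oct R) : u *m E = w *m E <-> u = w.
  by split=> [|->//]; exact: (can_inj (mulmxK frame_unit)).
rewrite /eigen_eq frame_assoc (cE (ha h)) (cE (hb h)) (cE (hc h)) -/a -/b -/d.
rewrite frame_x frame_y frame_z !(frame_conj, frame_mul).
rewrite !scalemxAl -!mulmxDl.
by split=> -[/inj ? /inj ? /inj ?]; split=> //; apply/inj.
Qed.

Lemma frame_chart p m n b0 b3 b6 : exists! h : 'rV[R]_27,
  [/\ eigen_eq h x y z, hp h = p, hm h = m, hn h = n &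
      let b := hb h *m invmx E in
      [/\ ocomp b 0 = b0, ocomp b 3 = b3 & ocomp b 6 = b6]].
Proof.
pose b := sol_b al be ga y2 z2 z3 z4 p m n b0 b3 b6.
pose a := sol_a al be ga y2 z2 z3 z4 m b.
pose c := sol_c al be ga y2 z2 z3 z4 n b.
have Eu := frame_unit.
have [b0E b3E b6E] : [/\ ocomp b 0 = b0, ocomp b 3 = b3 & ocomp b 6 = b6].
  by rewrite /b /sol_b !ocomp_mkoct.
exists (mkherm p m n (a *m E) (b *m E) (c *m E)); split=> [|h [/frame_eigen]].
  have [[hpE hmE hnE] [haE hbE hcE]] := mkhermK p m n (a *m E) (b *m E) (c *m E).
  split=> //; last by rewrite hbE mulmxK.
  by apply/frame_eigen; rewrite haE hbE hcE hpE hmE hnE !mulmxK // b0E b3E b6E.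
move=> [ea ec eb] hpE hmE hnE [b0h b3h b6h].
have [[hpE' hmE' hnE'] [haE hbE hcE]] := mkhermK p m n (a *m E) (b *m E) (c *m E).
move: eb; rewrite b0h b3h b6h hpE hmE hnE -/b => eb.
apply: herm_ext; rewrite ?hpE' ?hmE' ?hnE' ?haE ?hbE ?hcE //.
- by rewrite /a -eb -hmE -ea mulmxKV.
- by rewrite -eb mulmxKV.
- by rewrite /c -eb -hnE -ec mulmxKV.
Qed.

End Chart.

(** * Dimension six and the generic form *)

Lemma eigen_dim6 (R : realFieldType) (x y z : oct R) :
  ore x = 0 -> ore y = 0 -> ore z = 0 -> oassoc x y z != 0 ->
  exists (h0 : 'rV[R]_27) (B : 'M[R]_(6, 27)),
    \rank B = 6%N /\
    (forall h : 'rV[R]_27,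
       eigen_eq h x y z <-> exists t : 'rV[R]_6, h = h0 + t *m B).
Proof.
move=> x0 y0 z0 xyz.
have [e2 [e4 [y2 [z2 [z3 [z4 fr]]]]]] := frame_exists x0 y0 z0.
pose b (h : 'rV[R]_27) := hb h *m invmx (cd_basis x e2 e4).
(* The entries of [b] are taken in frame coordinates, where [frame_chart] applies. *)
pose F (h : 'rV[R]_27) : 'rV[R]_6 := \row_(i < 6)
  nth 0 [:: hp h; hm h; hn h; ocomp (b h) 0; ocomp (b h) 3; ocomp (b h) 6] i.
have FP h q : F h = q <->
    [/\ hp h = q 0 (inord 0), hm h = q 0 (inord 1), hn h = q 0 (inord 2) &
    [/\ ocomp (b h) 0 = q 0 (inord 3), ocomp (b h) 3 = q 0 (inord 4) &
        ocomp (b h) 6 = q 0 (inord 5)]].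
  split=> [<-|[e0 e1 e5 [e3 e6 e7]]]; first by rewrite !mxE !inordK.
  apply/rowP => i; rewrite mxE -[in RHS](inord_val i).
  by case: i => -[|[|[|[|[|[|//]]]]]].
have Flin k h h' : F (k *: h + h') = k *: F h + F h'.
  have [[e0 e1 e5] [_ e3 _]] := hermP k h h'.
  have bE : b (k *: h + h') = k *: b h + b h'.
    by rewrite /b e3 mulmxDl scalemxAl.
  apply/rowP => i; rewrite !mxE e0 e1 e5 bE /ocomp.
  by case: i => -[|[|[|[|[|[|//]]]]]] i6; rewrite /= ?mxE.
apply: (@affine_chart _ _ _ _ F).
- by move=> k h1 h2 h3; exact: eigen_affine.
- move=> k h1 h2 h3; rewrite addrC Flin [h2 - h3]addrC -scaleN1r Flin.
  by rewrite scaleN1r addrC [- _ + _]addrC.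
- move=> q; have [h [[Ph h0 h1 h2 hh] uniq]] := frame_chart fr xyz
    (q 0 (inord 0)) (q 0 (inord 1)) (q 0 (inord 2))
    (q 0 (inord 3)) (q 0 (inord 4)) (q 0 (inord 5)).
  exists h; split=> [|h' [Ph' /FP[? ? ? ?]]]; first by split=> //; apply/FP.
  exact: uniq.
Qed.

Lemma eigen_generic (R : realFieldType) (x y z : oct R) :
  generic_form x y z -> oassoc x y z != 0 ->
  forall p m n b1 b4 b7 : R,
    exists! h : 'rV[R]_27,
      [/\ eigen_eq h x y z, hp h = p, hm h = m, hn h = n &
          [/\ ocomp (hb h) 0 = b1, ocomp (hb h) 3 = b4 & ocomp (hb h) 6 = b7]].
Proof.
move=> [gx [gy gz]]; pose x2 := ocomp x 1; pose y3 := ocomp y 2.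
pose z8 := ocomp z 7.
have xE : x = mkoct [:: 0; x2; 0; 0; 0; 0; 0; 0].
  by rewrite [LHS]oct_eta /=; congr (mkoct [:: _; _; _; _; _; _; _; _]); exact: gx.
have yE : y = mkoct [:: 0; ocomp y 1; y3; 0; 0; 0; 0; 0].
  by rewrite [LHS]oct_eta /=; congr (mkoct [:: _; _; _; _; _; _; _; _]); exact: gy.
have zE : z = mkoct [:: 0; ocomp z 1; ocomp z 2; ocomp z 3; 0; 0; 0; z8].
  by rewrite [LHS]oct_eta /=; congr (mkoct [:: _; _; _; _; _; _; _; _]); exact: gz.
move: (ocomp y 1) (ocomp z 1) (ocomp z 2) (ocomp z 3) yE zE => y2 z2 z3 z4 yE zE xyz.
(* Here [x e2 = x2 y3 k] and [x e4 = x2 z8 il]: the frame is a rescaled standard basis. *)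
pose e2 : oct R := mkoct [:: 0; 0; y3; 0; 0; 0; 0; 0].
pose e4 : oct R := mkoct [:: 0; 0; 0; 0; 0; 0; 0; z8].
(* The associator is [2 x2 y3 z8 kl]. *)
have : x2 * y3 * z8 != 0.
  apply: contraNneq xyz => t0; rewrite /oassoc xE yE zE; oct_simpl.
  rewrite -mkoct0; apply/eqP; congr (mkoct [:: _; _; _; _; _; _; _; _]); try ring.
  by apply: (lin_comb (k := 2) t0); ring.
rewrite !mulf_eq0 !negb_or => /andP[/andP[x20 y30] z80].
have fr : frame x y z e2 e4 (y2 / x2) (z2 / x2) (z3 / y3) (z4 / (x2 * y3)).
  rewrite /frame xE yE zE /e2 /e4 -/x2; oct_simpl; rewrite !ore_mkoct !odot_mkoct.
  split=> //; first by split; ring.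
    by congr (mkoct [:: _; _; _; _; _; _; _; _]); field.
  by congr (mkoct [:: _; _; _; _; _; _; _; _]); field; rewrite ?x20 ?y30.
move=> p m n b1 b4 b7.
(* Coordinates 0, 3, 6 belong to [1], [x e2], [x e4], so the free parameters in the two bases differ
   by nonzero factors. *)
have bE w (u := w *m invmx (cd_basis x e2 e4)) :
    [/\ ocomp w 0 = ocomp u 0, ocomp w 3 = x2 * y3 * ocomp u 3 &
        ocomp w 6 = x2 * z8 * ocomp u 6].
  rewrite -[w](mulmxKV (frame_unit fr xyz)) -/u; move: u => u.
  rewrite xE /e2 /e4; oct_coords u; rewrite cd_basisE /cd2 /cd1 /oone; oct_simpl.
  by rewrite !ocomp_mkoct //=; split; ring.
have iffE h : [/\ ocomp (hb h) 0 = b1, ocomp (hb h) 3 = b4 & ocomp (hb h) 6 = b7] <->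
    let b := hb h *m invmx (cd_basis x e2 e4) in
    [/\ ocomp b 0 = b1, ocomp b 3 = b4 / (x2 * y3) & ocomp b 6 = b7 / (x2 * z8)].
  have xy0 : x2 * y3 != 0 by rewrite mulf_neq0.
  have xz0 : x2 * z8 != 0 by rewrite mulf_neq0.
  cbv zeta; have [-> -> ->] := bE (hb h).
  split=> -[-> e e']; split=> //.
  - by rewrite -e mulrC mulKf.
  - by rewrite -e' mulrC mulKf.
  - by rewrite e mulrC divfK.
  - by rewrite e' mulrC divfK.
have [h [[Ph ep em en /iffE eb] uniq]] :=
  frame_chart fr xyz p m n b1 (b4 / (x2 * y3)) (b7 / (x2 * z8)).
exists h; split=> // h' [Ph' ep' em' en' /iffE eb'].
exact: uniq.
Qed.

Theorem theorem2 (R : realFieldType) :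
  (* general statement: nonempty affine solution set of dimension 6 in R^27 *)
  (forall x y z : oct R,
     ore x = 0 -> ore y = 0 -> ore z = 0 -> oassoc x y z != 0 ->
     exists (h0 : 'rV[R]_27) (B : 'M[R]_(6, 27)),
       \rank B = 6%N /\
       (forall h : 'rV[R]_27,
          eigen_eq h x y z <-> exists t : 'rV[R]_6, h = h0 + t *m B))
  /\
  (* in generic form: p, m, n, b1, b4, b7 free, the rest uniquely determined *)
  (forall x y z : oct R,
     generic_form x y z -> oassoc x y z != 0 ->
     forall p m n b1 b4 b7 : R,
       exists! h : 'rV[R]_27,
         [/\ eigen_eq h x y z, hp h = p, hm h = m, hn h = n &
             [/\ ocomp (hb h) 0 = b1, ocomp (hb h) 3 = b4 & ocomp (hb h) 6 = b7]]).
Proof.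
by split; [exact: eigen_dim6|exact: eigen_generic].
Qed.
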